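(* If $G$ is a connected $\{P_5,K_4,\mathrm{Kite},\mathrm{Bull}\}$-free graph that contains an induced $C_5$, then $V(G)=V_1\cup V_2\cup V_3$ such that: (1) $\langle V_2\rangle$ is a complete bipartite graph with bipartition $B$ and $S$; (2) $\langle V_1\cup V_3\rangle$ is a disjoint union of $\mathbb{I}[C_5]$'s and bipartite graphs; (3) $[V_1,B]$ is complete, and $[V_1,S]=[V_1,V_3]=[V_3,B]=\emptyset$; and (4) there exists $x^*\in S$ such that $[x^*,V_3]$ is complete.
   Context: All graphs are finite, simple and undirected. $P_n$, $C_n$, $K_n$ denote the path, cycle and complete graph on $n$ vertices. For a family $\mathcal{F}$ of graphs, a graph is $\mathcal{F}$-free if it has no induced subgraph isomorphic to a member of $\mathcal{F}$. The Kite is the 5-vertex graph obtained from $K_4$ minus an edge by attaching a pendant vertex to one of its two vertices of degree 2. The Bull is the 5-vertex graph obtained from a triangle by attaching one pendant vertex to each of two distinct vertices of the triangle. For $X,Y\subseteq V(G)$, $\langle X\rangle$ is the subgraph of $G$ induced by $X$, and $[X,Y]$ is the set of all edges with one end in $X$ and the other in $Y$; $[X,Y]$ is complete if every vertex of $X$ is adjacent to every vertex of $Y$. For a vertex $x$, $[x,Y]$ means $[\{x\},Y]$. An independent expansion $\mathbb{I}[C_5]=\mathbb{I}[C_5](m_1,\dots,m_5)$, with every $m_i\ge 1$, is the graph obtained from $C_5$ with vertices $v_1,\dots,v_5$ by replacing each $v_i$ by an independent set of $m_i$ vertices and joining every vertex of the $i$-th set to every vertex of the $j$-th set whenever $v_i$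 and $v_j$ are adjacent in $C_5$.
   Formalization: Clause (4) is required only when V_1 ≠ V(G), since it is impossible for G = C_5 and for every I[C_5] (the only graphs where V_1 = V(G) can occur); the complete bipartite graph in (1) may have an empty side, as the 5-wheel forces. *)

(* Defs.v *)
From HB Require Import structures.
From mathcomp Require Import all_boot.

Set Implicit Arguments.
Unset Strict Implicit.
Unset Printing Implicit Defensive.

Record sgraph := SGraph {
  vertex :> finType;
  adj : rel vertex;
  adj_sym : symmetric adj;
  adj_irrefl : irreflexive adj
}.

(* The simple graph on T whose edges are the pairs {x, y}, x != y, with r x y
   or r y x: r need only list each edge in one direction. *)
Section OfRel.
Variables (T : finType) (r : rel T).

Definition sym_adj : rel T := fun x y => (x != y) && (r x y || r y x).

Lemma sym_adj_sym : symmetric sym_adj.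
Proof. by move=> x y; rewrite /sym_adj eq_sym orbC. Qed.

Lemma sym_adj_irrefl : irreflexive sym_adj.
Proof. by move=> x; rewrite /sym_adj eqxx. Qed.

Definition graph_of_rel : sgraph := SGraph sym_adj_sym sym_adj_irrefl.
End OfRel.

Definition path_graph (n : nat) : sgraph :=
  graph_of_rel (fun i j : 'I_n => val j == i.+1).

(* This is the n-cycle for n >= 3 only. *)
Definition cycle_graph (n : nat) : sgraph :=
  graph_of_rel (fun i j : 'I_n => val j == i.+1 %% n).

Definition complete_graph (n : nat) : sgraph :=
  graph_of_rel (fun _ _ : 'I_n => true).

Definition graph_of_edges (n : nat) (E : seq (nat * nat)) : sgraph :=
  graph_of_rel (fun i j : 'I_n => (val i, val j) \in E).

(* K_4 minus the edge {0, 3}, with the pendant vertex 4 attached to 3. *)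
Definition kite : sgraph :=
  graph_of_edges 5 [:: (0, 1); (0, 2); (1, 2); (1, 3); (2, 3); (3, 4)].

(* The triangle {0, 1, 2}, with pendant vertices 3 at 0 and 4 at 1. *)
Definition bull : sgraph :=
  graph_of_edges 5 [:: (0, 1); (0, 2); (1, 2); (0, 3); (1, 4)].

Definition isomorphic (G H : sgraph) : Prop :=
  exists2 f : G -> H, bijective f & forall x y, adj (f x) (f y) = adj x y.

Section Induced.
Variables (G : sgraph) (X : {set G}).

Definition induced_adj : rel {x : G | x \in X} := fun u v => adj (val u) (val v).

Lemma induced_adj_sym : symmetric induced_adj.
Proof. by move=> u v; rewrite /induced_adj adj_sym. Qed.

Lemma induced_adj_irrefl : irreflexive induced_adj.
Proof. by move=> u; rewrite /induced_adj adj_irrefl. Qed.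

Definition induced : sgraph := SGraph induced_adj_sym induced_adj_irrefl.
End Induced.

Definition contains_induced (G H : sgraph) : Prop :=
  exists X : {set G}, isomorphic (induced X) H.

Definition family_free (F : sgraph -> Prop) (G : sgraph) : Prop :=
  forall H : sgraph, F H -> ~ contains_induced G H.

Definition P5_K4_kite_bull (H : sgraph) : Prop :=
  [\/ H = path_graph 5, H = complete_graph 4, H = kite | H = bull].

Definition connected (G : sgraph) : Prop :=
  forall x y : G, connect (@adj G) x y.

Section Expansion.
Variable m : 'I_5 -> nat.

Definition expansion_adj : rel {i : 'I_5 & 'I_(m i)} :=
  fun u v => @adj (cycle_graph 5) (tag u) (tag v).

Lemma expansion_adj_sym : symmetric expansion_adj.
Proof. by move=> u v; apply: adj_sym. Qed.

Lemma expansion_adj_irrefl : irreflexive expansion_adj.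
Proof. by move=> u; apply: adj_irrefl. Qed.

Definition C5_expansion : sgraph :=
  SGraph expansion_adj_sym expansion_adj_irrefl.
End Expansion.

Definition is_C5_expansion (G : sgraph) : Prop :=
  exists2 m : 'I_5 -> nat, (forall i, 0 < m i) & isomorphic G (C5_expansion m).

Section Sets.
Variable G : sgraph.
Implicit Types X Y W : {set G}.

Definition edges_between X Y : {set {set G}} :=
  [set [set x; y] | x in X, y in Y & adj x y].

Definition complete_between X Y : Prop :=
  forall x y, x \in X -> y \in Y -> adj x y.

Definition independent X : Prop :=
  forall x y, x \in X -> y \in X -> ~~ adj x y.

(* B or S may be empty. *)
Definition complete_bipartite_on W (B S : {set G}) : Prop :=
  [/\ W = B :|: S, [disjoint B & S], independent B, independent S
    & complete_between B S].

(* <W> is the disjoint union of the graphs <X>, X ranging over some partition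
   of W, all satisfying P. *)
Definition disjoint_union_of (P : sgraph -> Prop) W : Prop :=
  exists2 D : {set {set G}},
    partition D W /\ (forall X, X \in D -> P (induced X))
    & forall X Y, X \in D -> Y \in D -> X != Y -> edges_between X Y = set0.
End Sets.

Definition bipartite (G : sgraph) : Prop :=
  exists2 A : {set G}, independent A & independent (~: A).

(* Main.v *)
Require Import Defs.
From mathcomp Require Import all_boot.

(* Fix an induced C5 and classify the vertices by their neighbours on it.  Every
   vertex is a false twin of a vertex of the C5, or is complete to it (a hub), or
   has no neighbour on it.  If no induced C5 has a hub, connectedness makes G an
   expansion of C5.  Otherwise let D be the independent set of hubs, A the set of
   twins, and split the remaining vertices into N (complete to D) and R
   (anticomplete to D); no other behaviour towards D is possible.  Take B = D,
   S = the vertices of N with a neighbour in R, V1 = A + (N \ S), V3 = R; when R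
   is empty, take instead S = D and V3 = A + N.  The neighbourhoods in R of the
   vertices of S are unions of components of R and form a chain, so one vertex
   of S dominates R.  As V1 and V3 each lie in a neighbourhood, K4-freeness makes
   them triangle-free, and a connected triangle-free P5-free graph is bipartite
   unless it contains an induced C5, in which case it is an expansion of C5. *)

Set Implicit Arguments.
Unset Strict Implicit.
Unset Printing Implicit Defensive.

(** * Preliminaries on induced subgraphs *)

Lemma disjoint_notin (T : finType) (A B : {set T}) :
  (forall x, x \in A -> x \notin B) -> [disjoint A & B].
Proof. by move=> nB; rewrite disjoint_subset; apply/subsetP=> x /nB. Qed.

Lemma contains_induced_embedding (G H : sgraph) (f : H -> G) :
    injective f -> (forall x y, adj (f x) (f y) = adj x y) ->
  contains_induced G H.
Proof.
move=> f_inj f_adj; exists [set y in codom f].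
have codomP (u : {y | y \in [set y in codom f]}) : val u \in codom f.
  by have := valP u; rewrite inE.
have mem_f x : f x \in [set y in codom f] by rewrite inE codom_f.
exists (fun u : induced [set y in codom f] => iinv (codomP u)); last first.
  by move=> u v; rewrite -f_adj !f_iinv.
exists (fun x => Sub (f x) (mem_f x)) => [u | x].
  by apply: val_inj; rewrite SubK f_iinv.
by apply: f_inj; rewrite f_iinv SubK.
Qed.

(* Without false twins in H, an adjacency-preserving and -reflecting map from H
   is automatically injective. *)
Lemma contains_induced_twin_free (G H : sgraph) (f : H -> G) :
    (forall x y : H, adj x =1 adj y -> x = y) ->
    (forall x y, adj (f x) (f y) = adj x y) ->
  contains_induced G H.
Proof.
move=> H_twin f_adj; apply: (contains_induced_embedding (f := f)) => // x y eq_f.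
by apply: H_twin => z; rewrite -!f_adj eq_f.
Qed.

(** * Connected vertex sets and components *)

(** Phrased as induction along edges, so that later proofs propagate a property without handling
    paths; the empty set counts as connected. *)
Definition connected_in (G : sgraph) (Q : {set G}) : Prop :=
  forall P : pred G, (exists2 x, x \in Q & P x) ->
    (forall x y, x \in Q -> y \in Q -> adj x y -> P x -> P y) ->
  forall y, y \in Q -> P y.

Definition triangle_free_on (G : sgraph) (Q : {set G}) : Prop :=
  forall x y z, x \in Q -> y \in Q -> z \in Q ->
  adj x y -> adj y z -> adj x z -> False.

Lemma connect_closed (T : finType) (e : rel T) (P : pred T) (x y : T) :
  (forall u v, e u v -> P u -> P v) -> connect e x y -> P x -> P y.
Proof.
move=> Pe /connectP[p]; elim: p x => [|z p IHp] x /= => [_ -> //|].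
by case/andP=> xz zp yE Px; apply: IHp zp yE (Pe _ _ xz Px).
Qed.

Lemma connected_setT (G : sgraph) : connected G -> connected_in [set: G].
Proof.
move=> Gconn P [x _ Px] Pe y _; apply: connect_closed (Gconn x y) Px => u v uv.
by apply: Pe; rewrite ?inE.
Qed.

Lemma edges_between_eq0 (G : sgraph) (X Y : {set G}) :
  (forall x y, x \in X -> y \in Y -> adj x y -> False) -> edges_between X Y = set0.
Proof.
move=> nXY; apply/setP=> e; rewrite inE; apply/negbTE/imset2P.
by case=> x y Xx; rewrite inE => /andP[Yy /(nXY x y Xx Yy)].
Qed.

(** The parts are the components of [W], obtained as classes of the reflexive-transitive closure of
    adjacency restricted to [W]. *)
Lemma disjoint_union_of_connected (G : sgraph) (P : sgraph -> Prop) (W : {set G}) :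
    (forall (Q : {set G}) x, Q \subset W -> x \in Q -> connected_in Q ->
       P (induced Q)) ->
  disjoint_union_of P W.
Proof.
move=> W_comp; pose e x y := [&& x \in W, y \in W & @adj G x y].
have e_sym : connect_sym e.
  by apply: sym_connect_sym => x y; rewrite /e adj_sym andbCA.
have e_equiv : {in W & &, equivalence_rel (connect e)}.
  by move=> x y z _ _ _; split=> [|/(same_connect e_sym)->].
exists (equivalence_partition (connect e) W); first split.
- exact: equivalence_partitionP.
- move=> _ /imsetP[x Wx ->]; apply: (W_comp _ x).
  + by apply/subsetP=> y; rewrite inE => /andP[].
  + by rewrite inE Wx connect0.
  move=> R [y /[!inE] /andP[Wy xy] Ry] Re z /[!inE] /andP[Wz xz].
  have yz: connect e y z by rewrite (same_connect e_sym xy) in xz *.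
  (* [R] is known to propagate only inside the class, so membership in the class travels along the
     walk together with [R]. *)
  suff /andP[]: [pred u | R u && connect e x u] z by [].
  apply: connect_closed yz _ => /= [u v uv /andP[Ru xu]|]; last by rewrite Ry.
  have xv := connect_trans xu (connect1 uv); have /and3P[Wu Wv auv] := uv.
  by rewrite xv andbT; apply: Re auv Ru; rewrite !inE ?Wu ?Wv.
move=> X Y /imsetP[x Wx ->] /imsetP[y Wy ->] neq; apply: edges_between_eq0 => u v.
rewrite !inE => /andP[Wu xu] /andP[Wv yv] uv; case/eqP: neq; apply/setP=> z.
have euv : connect e u v by apply: connect1; rewrite /e Wu Wv.
rewrite !inE (same_connect e_sym xu) (same_connect e_sym euv).
by rewrite (same_connect e_sym yv).
Qed.

(** * Recognising expansions of C5, and the shape of the conclusion *)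

(** The fibres of [t] are the five sets of the expansion, each numbered by its enumeration; they are
    independent because no vertex of C5 is adjacent to itself. *)
Lemma is_C5_expansion_of_map (G : sgraph) (Q : {set G}) (t : G -> 'I_5) :
    {in Q &, forall x y, adj x y = @adj (cycle_graph 5) (t x) (t y)} ->
    (forall i, exists2 x, x \in Q & t x = i) ->
  is_C5_expansion (induced Q).
Proof.
move=> t_adj t_surj; pose F i := [set x in Q | t x == i].
exists (fun i => #|F i|) => [i|].
  by have [x Qx tx] := t_surj i; apply/card_gt0P; exists x; rewrite inE Qx tx eqxx.
have FP (u : {x | x \in Q}) : val u \in F (t (val u)) by rewrite inE (valP u) eqxx.
have QP (p : {i : 'I_5 & 'I_#|F i|}) : enum_val (tagged p) \in Q.
  by have := enum_valP (tagged p); rewrite inE => /andP[].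
pose f (u : induced Q) : C5_expansion (fun i => #|F i|) :=
  Tagged (fun i => 'I_#|F i|) (enum_rank_in (FP u) (val u)).
pose g (p : C5_expansion (fun i => #|F i|)) : induced Q := Sub (enum_val (tagged p)) (QP p).
have fK : cancel f g by move=> u; apply: val_inj; rewrite SubK enum_rankK_in.
exists f; last by move=> u v; rewrite /= /induced_adj t_adj ?(valP u) ?(valP v).
exists g => //; apply: inj_can_sym fK _ => -[i a] [j b] /(congr1 val).
rewrite !SubK /= => eq_ab.
have ta : t (enum_val a) = i by have := enum_valP a; rewrite inE => /andP[_ /eqP].
have tb : t (enum_val b) = j by have := enum_valP b; rewrite inE => /andP[_ /eqP].
have eq_ij : i = j by rewrite -ta eq_ab.
by case: j / eq_ij b eq_ab {tb} => b /enum_val_inj ->.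
Qed.

(** The guard on the last clause is for the case without hubs, where [V1] is everything and [S] is
    empty. *)
Definition decomposition (G : sgraph) : Prop :=
  exists V1 V2 V3 B S : {set G},
    ([set: G] = V1 :|: V2 :|: V3 /\
     [/\ [disjoint V1 & V2], [disjoint V1 & V3] & [disjoint V2 & V3]]) /\
    [/\ complete_bipartite_on V2 B S,
        disjoint_union_of (fun H => is_C5_expansion H \/ bipartite H)
          (V1 :|: V3),
        [/\ complete_between V1 B, edges_between V1 S = set0,
            edges_between V1 V3 = set0 & edges_between V3 B = set0]
      & V1 != [set: G] ->
        exists2 x : G, x \in S & complete_between [set x] V3].

(** * Forbidden subgraphs as adjacency conditions *)

Section Free.
Variables (G : sgraph).

(** All pairs are written in cyclic order, so a rotation merely permutes the conjuncts. Distinctness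
    of the five vertices is implied. *)
Definition C5_on (v0 v1 v2 v3 v4 : G) : bool :=
  [&& [&& adj v0 v1, adj v1 v2, adj v2 v3, adj v3 v4 & adj v4 v0],
      ~~ adj v0 v2, ~~ adj v1 v3, ~~ adj v2 v4, ~~ adj v3 v0 & ~~ adj v4 v1].

Lemma C5_on_rot (v0 v1 v2 v3 v4 : G) :
  C5_on v0 v1 v2 v3 v4 -> C5_on v1 v2 v3 v4 v0.
Proof.
by case/and5P=> /and5P[a b c d e] f g h /andP[i j]; apply/and5P; split;
  [apply/and5P | | | | apply/andP].
Qed.

Lemma C5_on_contains : contains_induced G (cycle_graph 5) ->
  exists v0 v1 v2 v3 v4, C5_on v0 v1 v2 v3 v4.
Proof.
case=> X [f [g fK gK] f_adj].
pose v k (lt_k : k < 5) := val (g (Ordinal lt_k)).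
have v_adj i j (hi : i < 5) (hj : j < 5) :
    adj (v i hi) (v j hj) = @adj (cycle_graph 5) (Ordinal hi) (Ordinal hj).
  by have := f_adj (g (Ordinal hi)) (g (Ordinal hj)); rewrite !gK => ->.
exists (v 0 isT), (v 1 isT), (v 2 isT), (v 3 isT), (v 4 isT).
by rewrite /C5_on !v_adj.
Qed.

Hypothesis G_free : family_free P5_K4_kite_bull G.

(** Distinct vertices of a concrete 5-vertex graph are separated by evaluating their adjacencies to
    each of the five vertices. *)
Local Ltac twin_free_ord5 :=
  let h := fresh in
  case=> [[|[|[|[|[|//]]]]] ?] [[|[|[|[|[|//]]]]] ?]; intro h;
  try exact: val_inj;
  by move: (h (@Ordinal 5 0 isT)) (h (@Ordinal 5 1 isT)) (h (@Ordinal 5 2 isT))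
           (h (@Ordinal 5 3 isT)) (h (@Ordinal 5 4 isT)).

Lemma P5_free (a b c d e : G) :
  adj a b -> adj b c -> adj c d -> adj d e ->
  ~~ adj a c -> ~~ adj a d -> ~~ adj a e -> ~~ adj b d -> ~~ adj b e ->
  ~~ adj c e -> False.
Proof.
move=> ab bc cd de /negbTE ac /negbTE ad /negbTE ae /negbTE bd /negbTE be.
move=> /negbTE ce.
apply: (G_free (H := path_graph 5)); first by constructor.
apply: (@contains_induced_twin_free G (path_graph 5)
          (fun i : 'I_5 => nth a [:: a; b; c; d; e] i)); first twin_free_ord5.
case=> [[|[|[|[|[|//]]]]] ?] [[|[|[|[|[|//]]]]] ?];
  rewrite /= ?adj_irrefl //; first
  [by rewrite ?(ab, bc, cd, de, ac, ad, ae, bd, be, ce)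
  | by rewrite adj_sym ?(ab, bc, cd, de, ac, ad, ae, bd, be, ce)].
Qed.

Lemma kite_free (a b c d e : G) :
  adj a b -> adj a c -> adj b c -> adj b d -> adj c d -> adj d e ->
  ~~ adj a d -> ~~ adj a e -> ~~ adj b e -> ~~ adj c e -> False.
Proof.
move=> ab ac bc bd cd de /negbTE ad /negbTE ae /negbTE be /negbTE ce.
apply: (G_free (H := kite)); first by constructor.
apply: (@contains_induced_twin_free G kite
          (fun i : 'I_5 => nth a [:: a; b; c; d; e] i)); first twin_free_ord5.
case=> [[|[|[|[|[|//]]]]] ?] [[|[|[|[|[|//]]]]] ?];
  rewrite /= ?adj_irrefl //; first
  [by rewrite ?(ab, bc, cd, de, ac, ad, ae, bd, be, ce)
  | by rewrite adj_sym ?(ab, bc, cd, de, ac, ad, ae, bd, be, ce)].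
Qed.

Lemma bull_free (a b c d e : G) :
  adj a b -> adj a c -> adj b c -> adj a d -> adj b e ->
  ~~ adj a e -> ~~ adj b d -> ~~ adj c d -> ~~ adj c e -> ~~ adj d e -> False.
Proof.
move=> ab ac bc ad be /negbTE ae /negbTE bd /negbTE cd /negbTE ce /negbTE de.
apply: (G_free (H := bull)); first by constructor.
apply: (@contains_induced_twin_free G bull
          (fun i : 'I_5 => nth a [:: a; b; c; d; e] i)); first twin_free_ord5.
case=> [[|[|[|[|[|//]]]]] ?] [[|[|[|[|[|//]]]]] ?];
  rewrite /= ?adj_irrefl //; first
  [by rewrite ?(ab, bc, cd, de, ac, ad, ae, bd, be, ce)
  | by rewrite adj_sym ?(ab, bc, cd, de, ac, ad, ae, bd, be, ce)].
Qed.

Lemma K4_free (a b c d : G) :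
  adj a b -> adj a c -> adj a d -> adj b c -> adj b d -> adj c d -> False.
Proof.
move=> ab ac ad bc bd cd.
apply: (G_free (H := complete_graph 4)); first by constructor.
apply: (@contains_induced_twin_free G (complete_graph 4)
          (fun i : 'I_4 => nth a [:: a; b; c; d] i)).
  case=> [[|[|[|[|//]]]] ?] [[|[|[|[|//]]]] ?] h; try exact: val_inj;
  by move: (h (@Ordinal 4 0 isT)) (h (@Ordinal 4 1 isT)) (h (@Ordinal 4 2 isT))
           (h (@Ordinal 4 3 isT)).
case=> [[|[|[|[|//]]]] ?] [[|[|[|[|//]]]] ?];
  rewrite /= ?adj_irrefl //; first
  [by rewrite ?(ab, bc, cd, ac, ad, bd)
  | by rewrite adj_sym ?(ab, bc, cd, ac, ad, bd)].
Qed.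

(** * Neighbourhoods on a fixed induced C5 *)

Definition twin (x y : G) : bool := [forall z, adj x z == adj y z].

Lemma twinP (x y : G) : reflect (adj x =1 adj y) (twin x y).
Proof. by apply: (iffP forallP) => h z; apply/eqP. Qed.

Lemma twin_refl (x : G) : twin x x.
Proof. exact/twinP. Qed.

Section Cycle.
Variables v0 v1 v2 v3 v4 : G.
Hypothesis C5 : C5_on v0 v1 v2 v3 v4.
Variable x : G.

(** [x - v0 - v1 - v2 - v3] would be an induced P5. *)
Lemma C5_on_no_end : adj x v0 -> ~~ adj x v1 -> ~~ adj x v2 -> ~~ adj x v3 -> False.
Proof.
case/and5P: C5 => /and5P[h01 h12 h23 h34 h40] n02 n13 n24 /andP[n30 n41].
by move=> *; apply: (@P5_free x v0 v1 v2 v3) => //; rewrite adj_sym.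
Qed.

(** [v0, x, v1, v2] would induce K4 minus the edge [v0 v2], with [v3] pendant at [v2]: a kite. *)
Lemma C5_on_no_interval3 :
  adj x v0 -> adj x v1 -> adj x v2 -> ~~ adj x v3 -> False.
Proof.
case/and5P: C5 => /and5P[h01 h12 h23 h34 h40] n02 n13 n24 /andP[n30 n41].
by move=> *; apply: (@kite_free v0 x v1 v2 v3) => //; rewrite adj_sym.
Qed.

(** The triangle [v0, v1, x] would have pendants [v4] at [v0] and [v2] at [v1]: a bull. *)
Lemma C5_on_no_edge :
  adj x v0 -> adj x v1 -> ~~ adj x v2 -> ~~ adj x v4 -> False.
Proof.
case/and5P: C5 => /and5P[h01 h12 h23 h34 h40] n02 n13 n24 /andP[n30 n41].
by move=> *; apply: (@bull_free v0 v1 x v4 v2) => //; rewrite adj_sym.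
Qed.
End Cycle.

Definition trace (v0 v1 v2 v3 v4 x : G) : seq bool :=
  [seq adj x v | v <- [:: v0; v1; v2; v3; v4]].

(** In order: no neighbour, a hub, and the traces of the five cycle vertices; the unrotated pattern
    is that of [v1]. *)
Definition C5_traces : seq (seq bool) :=
  [:: nseq 5 false, nseq 5 true
    & [seq rot i [:: true; false; true; false; false] | i <- iota 0 5]].

(** The three exclusions above, applied in all five rotations, eliminate 25 of the 32 patterns. *)
Lemma C5_on_trace (v0 v1 v2 v3 v4 x : G) :
  C5_on v0 v1 v2 v3 v4 -> trace v0 v1 v2 v3 v4 x \in C5_traces.
Proof.
move=> C0; have C1 := C5_on_rot C0; have C2 := C5_on_rot C1.
have C3 := C5_on_rot C2; have C4 := C5_on_rot C3.
move: (C5_on_no_end C0 (x := x)) (C5_on_no_end C1 (x := x)) (C5_on_no_end C2 (x := x))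
  (C5_on_no_end C3 (x := x)) (C5_on_no_end C4 (x := x)).
move: (C5_on_no_interval3 C0 (x := x)) (C5_on_no_interval3 C1 (x := x))
  (C5_on_no_interval3 C2 (x := x))
  (C5_on_no_interval3 C3 (x := x)) (C5_on_no_interval3 C4 (x := x)).
move: (C5_on_no_edge C0 (x := x)) (C5_on_no_edge C1 (x := x)) (C5_on_no_edge C2 (x := x))
  (C5_on_no_edge C3 (x := x)) (C5_on_no_edge C4 (x := x)).
rewrite /trace /=.
by do 5![case: (adj x _)] => //=; do ?[case/(_ isT isT isT isT) | move=> _].
Qed.

(* Replacing v1 by x gives another induced C5, and two admissible traces never
   differ in exactly one coordinate. *)
Lemma C5_on_twin (v0 v1 v2 v3 v4 x : G) : C5_on v0 v1 v2 v3 v4 ->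
  trace v0 v1 v2 v3 v4 x = [:: true; false; true; false; false] -> twin x v1.
Proof.
move=> C5 [x0 x1 x2 x3 x4].
have C5' : C5_on v0 x v2 v3 v4.
  case/and5P: C5 => /and5P[h01 h12 h23 h34 h40] n02 n13 n24 /andP[n30 n41].
  by rewrite /C5_on h23 h34 h40 n02 n24 n30 (adj_sym v0) (adj_sym v4) x0 x2 x3 x4.
apply/twinP => y; move: (C5_on_trace y C5) (C5_on_trace y C5').
rewrite /trace /= !(adj_sym y).
by do 6![case: (adj _ y)].
Qed.

Lemma C5_on_trichotomy (v0 v1 v2 v3 v4 x : G) (c := [:: v0; v1; v2; v3; v4]) :
  C5_on v0 v1 v2 v3 v4 -> [|| has (twin x) c, all (adj x) c | ~~ has (adj x) c].
Proof.
move=> C0; have C1 := C5_on_rot C0; have C2 := C5_on_rot C1.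
have C3 := C5_on_rot C2; have C4 := C5_on_rot C3.
move: (C5_on_trace x C0) (C5_on_twin (x := x) C0) (C5_on_twin (x := x) C1)
  (C5_on_twin (x := x) C2) (C5_on_twin (x := x) C3) (C5_on_twin (x := x) C4).
rewrite /trace /c /=.
case: (adj x v0); case: (adj x v1); case: (adj x v2); case: (adj x v3);
 case: (adj x v4) => //= _ T0 T1 T2 T3 T4;
  first [by rewrite !orbT | by rewrite T0 ?orbT | by rewrite T1 ?orbT | by rewrite T2 ?orbT
        | by rewrite T3 ?orbT | by rewrite T4 ?orbT].
Qed.

(** Being a twin of a cycle vertex spreads along edges of [Q]: a neighbour of such a twin has a
    neighbour on the cycle, and, not being a hub, is itself a twin. The position of the twin on the
    cycle is the map to C5. *)
Lemma connected_C5_expansion (Q : {set G}) (v0 v1 v2 v3 v4 : G)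
    (c := [:: v0; v1; v2; v3; v4]) :
    connected_in Q -> C5_on v0 v1 v2 v3 v4 -> all (mem Q) c ->
    (forall d, d \in Q -> ~~ all (adj d) c) ->
  is_C5_expansion (induced Q).
Proof.
move=> Qconn C5 Qc Qfull.
have Q_twin x : x \in Q -> has (twin x) c.
  apply: (Qconn (fun x => has (twin x) c)) => [|{}x y Qx Qy xy /hasP[v cv /twinP xv]].
    by exists v0; [case/andP: Qc | rewrite /= twin_refl].
  case/or3P: (C5_on_trichotomy y C5) => // [yfull|/hasPn/(_ v cv)].
    by have := Qfull y Qy; rewrite yfull.
  by rewrite adj_sym -xv xy.
pose t x : 'I_5 := inord (find (twin x) c).
have t_adj x : x \in Q -> adj x =1 adj (nth v0 c (t x)).
  move=> /Q_twin xc; apply/twinP; rewrite /t inordK; last by rewrite has_find in xc.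
  exact: nth_find.
have c_adj (i j : 'I_5) : adj (nth v0 c i) (nth v0 c j) = @adj (cycle_graph 5) i j.
  case/and5P: C5 => /and5P[h01 h12 h23 h34 h40] /negbTE n02 /negbTE n13 /negbTE n24.
  case/andP=> /negbTE n30 /negbTE n41.
  case: i j => [[|[|[|[|[|//]]]]] ?] [[|[|[|[|[|//]]]]] ?];
  rewrite /= ?adj_irrefl //; first
  [by rewrite ?(h01, h12, h23, h34, h40, n02, n13, n24, n30, n41)
  | by rewrite adj_sym ?(h01, h12, h23, h34, h40, n02, n13, n24, n30, n41)].
have Qnth (i : 'I_5) : nth v0 c i \in Q by apply: (allP Qc); rewrite mem_nth.
apply: (is_C5_expansion_of_map (t := t)) => [x y Qx Qy | i].
  by rewrite t_adj // adj_sym t_adj // adj_sym c_adj.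
exists (nth v0 c i) => //.
(* C5 has no false twins, so [t] sends each cycle vertex to its own position, whence
   surjectivity. *)
have eq_adj : @adj (cycle_graph 5) (t (nth v0 c i)) =1 @adj (cycle_graph 5) i.
  by move=> j; rewrite -!c_adj -t_adj.
move: eq_adj; move: (t _) => k; move: k i {Qnth}; twin_free_ord5.
Qed.

(** * Connected triangle-free P5-free graphs *)

(** Vertices are split by the parity of their distance from [x0]. P5-freeness bounds this distance
    by three; an edge inside the even class produces a C5, and one inside the odd class is
    impossible. *)
Lemma P5_free_bipartite_or_C5 (Q : {set G}) (x0 : G) : connected_in Q ->
    triangle_free_on Q -> x0 \in Q ->
  (exists v0 v1 v2 v3 v4,
     C5_on v0 v1 v2 v3 v4 /\ all (mem Q) [:: v0; v1; v2; v3; v4])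
  \/ bipartite (induced Q).
Proof.
move=> Qconn Qtri Qx0.
(* [x0] itself may satisfy this, which is consistent with its being even. *)
pose two_steps y := ~~ adj x0 y && [exists x in Q, adj x0 x && adj x y].
have two_stepsP y : reflect (~~ adj x0 y /\
    exists x, [/\ x \in Q, adj x0 x & adj x y]) (two_steps y).
  apply: (iffP andP) => [[n0y /exists_inP[x Qx /andP[]]]|[n0y [x [Qx h0x hxy]]]].
    by split=> //; exists x.
  by split=> //; apply/exists_inP; exists x; rewrite ?h0x.
pose even y := (y == x0) || two_steps y.
have not_even z y : two_steps z -> adj z y -> ~~ even y -> ~~ adj x0 y ->
    exists x, [/\ x \in Q, adj x0 x, adj x z, ~~ adj x y & ~~ adj x0 z].
  move=> /two_stepsP[n0z [x [Qx h0x xz]]] zy /norP[_ n2y] n0y.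
  exists x; split=> //; apply: contra n2y => xy; apply/two_stepsP.
  by split=> //; exists x.
(* A vertex [w] at distance four would give an induced P5 [x0 - x - z - y - w]. *)
have near y : y \in Q ->
    [|| even y, adj x0 y | [exists z in Q, two_steps z && adj z y]].
  apply: (Qconn (fun y => [|| even y, adj x0 y |
            [exists z in Q, two_steps z && adj z y]])) => [|{}y w Qy Qw yw /=].
    by exists x0; rewrite /even ?eqxx.
  case h0w: (adj x0 w); first by rewrite orbT.
  case h0y: (adj x0 y).
    move=> _; apply/orP; left; apply/orP; right; apply/two_stepsP.
    by split; [rewrite h0w | exists y].
  case Ey: (even y).
    move=> _; apply/orP; right; apply/exists_inP; exists y => //; rewrite yw andbT.
    by case/orP: Ey => // /eqP eqy; rewrite -eqy yw in h0w.
  move=> /= /exists_inP[z Qz /andP[z2 zy]].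
  case Ew: (even w) => //=.
  have [x [Qx h0x xz nxy n0z]] := not_even z y z2 zy (negbT Ey) (negbT h0y).
  apply/exists_inP; exists z => //; rewrite z2 /=; apply/negP => /negP nzw.
  have nxw : ~~ adj x w.
    apply/negP => xw; move/norP: (negbT Ew) => [_ /two_stepsP[]].
    by split; [rewrite h0w | exists x].
  by apply: (P5_free h0x xz zy yw); rewrite ?h0y ?h0w.
(* An edge [y y'] at distance two closes up to the cycle [x0, x, y, y', x']; triangle-freeness
   excludes the chords not ruled out by [two_steps]. *)
have [/exists_inP[y Qy /exists_inP[y' Qy' /and3P[y2 y'2 yy']]] | noC5] :=
    boolP [exists y in Q, exists y' in Q, [&& two_steps y, two_steps y' & adj y y']].
  left; case/two_stepsP: y2 => n0y [x [Qx h0x xy]].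
  case/two_stepsP: y'2 => n0y' [x' [Qx' h0x' x'y']].
  exists x0, x, y, y', x'; rewrite /= Qx0 Qx Qy Qy' Qx'; split=> //.
  rewrite /C5_on h0x xy yy' (adj_sym y') x'y' (adj_sym x') h0x' n0y (adj_sym y') n0y'.
  rewrite /=; apply/and3P; split; apply/negP.
  - by move=> xy'; apply: (Qtri x y y').
  - by move=> yx'; apply: (Qtri x' y y'); rewrite // adj_sym.
  - by move=> x'x; apply: (Qtri x0 x x'); rewrite // adj_sym.
right; exists [set u : induced Q | even (val u)];
  move=> -[y Qy] [y' Qy']; rewrite !inE /= /induced_adj /=.
  move=> /orP[/eqP->|u2] /orP[/eqP->|v2]; rewrite ?adj_irrefl //.
  - by case/two_stepsP: v2.
  - by rewrite adj_sym; case/two_stepsP: u2.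
  apply: contra noC5 => uv; apply/exists_inP; exists y => //.
  by apply/exists_inP; exists y'; rewrite // u2 v2.
(* If one of two adjacent odd vertices is a neighbour of [x0], so is the other, giving a triangle;
   otherwise [x0 - x - z - y - y'] is an induced P5. *)
move=> Ey Ey'; apply/negP => yy'.
have odd_adj a b : a \in Q -> adj a b -> ~~ even b -> adj x0 a -> adj x0 b.
  move=> Qa ab /norP[_ n2b] h0a; apply: contraNT n2b => n0b; apply/two_stepsP.
  by split=> //; exists a.
have [h0y|n0y] := boolP (adj x0 y).
  by apply: (Qtri x0 y y') => //; apply: odd_adj yy' Ey' _.
have n0y' : ~~ adj x0 y'.
  by apply: contra n0y => h0y'; apply: odd_adj Ey h0y'; rewrite // adj_sym.
have := near y Qy; rewrite (negbTE Ey) (negbTE n0y) => /exists_inP[z Qz /andP[z2 zy]].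
have [x [Qx h0x xz nxy n0z]] := not_even z y z2 zy Ey n0y.
have nzy' : ~~ adj z y' by apply/negP => zy'; apply: (Qtri z y y').
have nxy' : ~~ adj x y'.
  apply/negP => xy'; case/norP: Ey' => _ /two_stepsP[]; split=> //.
  by exists x.
exact: (P5_free h0x xz zy yy').
Qed.

(** A hub in [Q] would form a triangle with an edge of the C5. *)
Lemma triangle_free_component (Q : {set G}) (x0 : G) : connected_in Q ->
    triangle_free_on Q -> x0 \in Q ->
  is_C5_expansion (induced Q) \/ bipartite (induced Q).
Proof.
move=> Qconn Qtri Qx0.
have [[v0 [v1 [v2 [v3 [v4 [C5 Qc]]]]]]|] := P5_free_bipartite_or_C5 Qconn Qtri Qx0;
  last by right.
left; apply: (connected_C5_expansion Qconn C5 Qc) => d Qd; apply/negP.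
case/and5P=> dv0 dv1 _ _ _; case/and5P: Qc => Qv0 Qv1 _ _ _.
by case/and5P: C5 => /and5P[v01 _ _ _ _] _ _ _ _; apply: (Qtri d v0 v1).
Qed.

Lemma triangle_free_disjoint_union (W : {set G}) : triangle_free_on W ->
  disjoint_union_of (fun H => is_C5_expansion H \/ bipartite H) W.
Proof.
move=> Wtri; apply: disjoint_union_of_connected => Q x /subsetP QW Qx Qconn.
apply: (triangle_free_component (x0 := x)) => // a b c *.
by apply: (Wtri a b c) => //; apply: QW.
Qed.

Lemma neighbourhood_triangle_free (W : {set G}) (d : G) :
  {in W, forall x, adj d x} -> triangle_free_on W.
Proof. by move=> dW x y z *; apply: (@K4_free d x y z) => //; apply: dW. Qed.

Lemma triangle_free_onU (X Y : {set G}) :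
    triangle_free_on X -> triangle_free_on Y ->
    (forall x y, x \in X -> y \in Y -> ~~ adj x y) ->
  triangle_free_on (X :|: Y).
Proof.
move=> Xtri Ytri nXY x y z; rewrite !inE.
move=> /orP[Xx|Yx] /orP[Xy|Yy] /orP[Xz|Yz] xy yz xz;
  [exact: (Xtri x y z) | | | | | | | exact: (Ytri x y z)].
- by case/negP: (nXY _ _ Xx Yz).
- by case/negP: (nXY _ _ Xx Yy).
- by case/negP: (nXY _ _ Xx Yy).
- by case/negP: (nXY _ _ Xy Yx); rewrite adj_sym.
- by case/negP: (nXY _ _ Xy Yx); rewrite adj_sym.
- by case/negP: (nXY _ _ Xz Yx); rewrite adj_sym.
Qed.

(** * The decomposition around a hub *)

Section Hub.
Variables v0 v1 v2 v3 v4 d : G.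
Let c := [:: v0; v1; v2; v3; v4].
Hypotheses (C5 : C5_on v0 v1 v2 v3 v4) (d_hub : all (adj d) c).

Let A := [set x | has (twin x) c].
Let D := [set x | all (adj x) c].
(** [N] and [R] are separated by the single hub [d]; [N_hub] and [R_hub] show that every hub
    separates them in the same way. *)
Let N := [set x | ~~ has (adj x) c & adj x d].
Let R := [set x | ~~ has (adj x) c & ~~ adj x d].
Let S := [set x in N | [exists r in R, adj x r]].

Lemma adj01 : adj v0 v1. Proof. by case/andP: C5 => /and5P[]. Qed.

Lemma hub_adj0 x : x \in D -> adj x v0.
Proof. by rewrite inE => /andP[]. Qed.

Lemma hub_adj1 x : x \in D -> adj x v1.
Proof. by rewrite inE => /and3P[]. Qed.

Lemma v0_c : v0 \in c. Proof. by rewrite inE eqxx. Qed.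

Lemma v1_c : v1 \in c. Proof. by rewrite !inE eqxx orbT. Qed.

Lemma far_adj x v : x \in N :|: R -> v \in c -> ~~ adj x v.
Proof.
move=> NRx cv; suff /hasPn/(_ v cv) : ~~ has (adj x) c by [].
by case/setUP: NRx; rewrite inE => /andP[].
Qed.

Lemma hub_d : d \in D. Proof. by rewrite inE. Qed.

Lemma A_twin x : x \in A -> exists2 v, v \in c & adj x =1 adj v.
Proof. by rewrite inE => /hasP[v cv /twinP]; exists v. Qed.

Lemma c_has_nbr v : v \in c -> has (adj v) c.
Proof.
case/and5P: C5 => /and5P[h01 h12 h23 h34 h40] _ _ _ _.
rewrite !inE => /or4P[||| /orP[]] /eqP->;
  by rewrite /= ?(h01, h12, h23, h34, h40) ?orbT.
Qed.

Lemma A_hub x y : x \in A -> y \in D -> adj x y.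
Proof.
move=> /A_twin[v cv ->]; rewrite inE adj_sym => /allP; exact.
Qed.

Lemma A_far x y : x \in A -> y \in N :|: R -> ~~ adj x y.
Proof. by move=> /A_twin[v cv ->] NRy; rewrite adj_sym far_adj. Qed.

Lemma A_notin_D x : x \in A -> x \notin D.
Proof.
by move=> Ax; apply/negP => /(A_hub Ax); rewrite adj_irrefl.
Qed.

Lemma far_notin_A x : x \in N :|: R -> x \notin A.
Proof.
move=> NRx; apply/negP => /A_twin[v cv xv]; have /hasP[w cw] := c_has_nbr cv.
by rewrite -xv; apply/negP/far_adj.
Qed.

Lemma far_notin_D x : x \in N :|: R -> x \notin D.
Proof. by move=> NRx; apply/negP => /hub_adj0; apply/negP/far_adj/v0_c. Qed.

Lemma classes_cover x : [|| x \in A, x \in D, x \in N | x \in R].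
Proof.
rewrite !inE; case/or3P: (C5_on_trichotomy x C5) => ->; rewrite ?orbT //=.
by case: (adj x d); rewrite ?orbT.
Qed.

(** Two adjacent hubs and the edge [v0 v1] would form a K4. *)
Lemma hub_independent : independent D.
Proof.
move=> x y Dx Dy; apply/negP => xy.
by apply: (K4_free xy (hub_adj0 Dx) (hub_adj1 Dx) (hub_adj0 Dy) (hub_adj1 Dy) adj01).
Qed.

(** Otherwise [z, v0, v1, y] induce K4 minus the edge [z y], and [x] pendant at [y] completes a
    kite. *)
Lemma far_hub x y z : x \in N :|: R -> y \in D -> z \in D -> adj x y -> adj x z.
Proof.
move=> NRx Dy Dz xy; apply: contraT => nxz; exfalso.
have nx v : v \in c -> ~~ adj v x by move=> cv; rewrite adj_sym far_adj.
apply: (@kite_free z v0 v1 y x).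
- exact: hub_adj0.
- exact: hub_adj1.
- exact: adj01.
- by rewrite adj_sym hub_adj0.
- by rewrite adj_sym hub_adj1.
- by rewrite adj_sym.
- exact: hub_independent.
- by rewrite adj_sym.
- exact/nx/v0_c.
- exact/nx/v1_c.
Qed.

Lemma N_hub x y : x \in N -> y \in D -> adj x y.
Proof.
move=> Nx Dy; apply: (@far_hub x d y) => //; first by rewrite inE Nx.
  exact: hub_d.
by move: Nx; rewrite inE => /andP[].
Qed.

Lemma R_hub x y : x \in R -> y \in D -> ~~ adj x y.
Proof.
move=> Rx Dy; apply/negP => xy.
have : adj x d by apply: (@far_hub x y d) => //; [rewrite inE Rx orbT | exact: hub_d].
by move: Rx; rewrite inE => /andP[_ /negP].
Qed.

Lemma N_notin_R x : x \in N -> x \notin R.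
Proof. by rewrite !inE => /andP[-> ->]. Qed.

(** An edge [x y] makes a triangle with [d]. With [r] a neighbour of [x] in [R], the vertices
    [x, y, d, r, v0] induce a kite if [y] is adjacent to [r], and a bull otherwise. *)
Lemma S_isolated x y : x \in S -> y \in N -> ~~ adj x y.
Proof.
rewrite inE => /andP[Nx /exists_inP[r Rr xr]] Ny; apply/negP => xy.
have Dd := hub_d; have dx : adj d x by rewrite adj_sym N_hub.
have dy : adj d y by rewrite adj_sym N_hub.
have dv0 := hub_adj0 Dd.
have nv z : z \in N :|: R -> ~~ adj z v0 by move=> ?; apply/far_adj/v0_c.
have [nx ny nr] : [/\ ~~ adj x v0, ~~ adj y v0 & ~~ adj r v0].
  by split; apply: nv; rewrite inE ?Nx ?Ny ?Rr ?orbT.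
have ndr : ~~ adj r d by apply: R_hub.
have [yr|nyr] := boolP (adj y r).
  by apply: (@kite_free r x y d v0) => //; rewrite adj_sym.
by apply: (@bull_free x d y r v0) => //; rewrite adj_sym.
Qed.

(** Otherwise [y - x - s - d - v0] is an induced P5. *)
Lemma S_spread s x y : s \in S -> x \in R -> y \in R ->
  adj x y -> adj s x -> adj s y.
Proof.
move=> Ss Rx Ry xy sx; apply: contraT => nsy; exfalso.
have Ns : s \in N by move: Ss; rewrite inE => /andP[].
have Dd := hub_d.
have nv0 z : z \in N :|: R -> ~~ adj z v0 by move=> ?; apply/far_adj/v0_c.
apply: (@P5_free y x s d v0).
- by rewrite adj_sym.
- by rewrite adj_sym.
- exact: N_hub.
- exact: hub_adj0.
- by rewrite adj_sym.
- exact: R_hub.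
- by apply: nv0; rewrite inE Ry orbT.
- exact: R_hub.
- by apply: nv0; rewrite inE Rx orbT.
- by apply: nv0; rewrite inE Ns.
Qed.

Hypothesis G_connected : connected G.

(** The vertices of [R] without a neighbour in [S] form a set closed under adjacency; if nonempty,
    it would contain [d] by connectedness. *)
Lemma R_has_S r : r \in R -> exists2 s, s \in S & adj s r.
Proof.
move=> Rr; apply/exists_inP; apply: contraT => nSr.
pose P x := (x \in R) && ~~ [exists s in S, adj s x].
suff /andP[Rd _] : P d by have := far_notin_D (subsetP (subsetUr N R) d Rd); rewrite hub_d.
apply: connect_closed (G_connected r d) _ => [x y xy /andP[Rx nSx]|]; last by rewrite /P Rr.
have NRx : x \in N :|: R by rewrite inE Rx orbT.
case/or4P: (classes_cover y) => [Ay|Dy|Ny|Ry].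
- by have := A_far Ay NRx; rewrite adj_sym xy.
- by have := R_hub Rx Dy; rewrite xy.
- case/exists_inP: nSx; exists y; last by rewrite adj_sym.
  by rewrite inE Ny; apply/exists_inP; exists x; rewrite // adj_sym.
rewrite /P Ry; apply: contra nSx => /exists_inP[s Ss sy]; apply/exists_inP.
by exists s => //; apply: S_spread sy; rewrite // adj_sym.
Qed.

Lemma S_sub_N s : s \in S -> s \in N.
Proof. by rewrite inE => /andP[]. Qed.

(* The neighbourhoods of S in R form a chain: incomparable s and s' would give
   an induced P5 r1 - s - d - s' - r. *)
Lemma dominating_S r0 : r0 \in R ->
  exists2 s, s \in S & {in R, forall r, adj s r}.
Proof.
move=> Rr0; have [s0 Ss0 _] := R_has_S Rr0.
pose nbR s := [set r in R | adj s r].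
have nbRE t x : (x \in nbR t) = (x \in R) && adj t x by rewrite inE.
have [s] := @arg_maxnP _ s0 (mem S) (fun s => #|nbR s|) Ss0.
rewrite -[mem S s]/(s \in S) => Ss s_max.
exists s => // r Rr; apply: contraT => nsr; exfalso.
have [s' Ss' s'r] := R_has_S Rr.
have [r1 Rr1 /andP[sr1 ns'r1]] : exists2 r1, r1 \in R & adj s r1 && ~~ adj s' r1.
  apply/exists_inP; apply: contraT => /exists_inPn nr1.
  have : #|nbR s| < #|nbR s'|.
    apply: proper_card; apply/properP; split; last first.
      by exists r; rewrite nbRE Rr ?s'r // (negbTE nsr).
    apply/subsetP=> x; rewrite !nbRE => /andP[Rx sx]; rewrite Rx /=.
    by have := nr1 x Rx; rewrite sx negbK.
  by rewrite ltnNge => /negP; case; apply: s_max Ss'.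
have [Ns Ns'] := (S_sub_N Ss, S_sub_N Ss'); have Dd := hub_d.
apply: (@P5_free r1 s d s' r).
- by rewrite adj_sym.
- exact: N_hub.
- by rewrite adj_sym N_hub.
- by [].
- exact: R_hub.
- by rewrite adj_sym.
- by apply: contra nsr => r1r; apply: S_spread sr1.
- exact: S_isolated.
- by [].
- by rewrite adj_sym R_hub.
Qed.

Lemma hub_decomposition : decomposition G.
Proof.
have NW x : x \in A :|: N -> adj d x.
  by rewrite adj_sym; case/setUP => [/A_hub|/N_hub]; apply; apply: hub_d.
have ANtri := neighbourhood_triangle_free NW.
have [R0|[r0 Rr0]] := set_0Vmem R.
  have AND x : x \in A :|: N -> x \notin D.
    by case/setUP=> [/A_notin_D|Nx] //; apply: far_notin_D; rewrite inE Nx.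
  (* With [R] empty the set [S] is empty too, so the hubs take over its role and [d] is the
     dominating vertex. *)
  exists set0, D, (A :|: N), set0, D; split; last split.
  - split; last split; rewrite -?setI_eq0 ?set0I //.
      apply/setP=> x; have := classes_cover x; rewrite R0 !in_setU !in_set0 in_setT.
      by rewrite orbF orbCA => ->.
    rewrite setI_eq0 disjoint_sym; apply: disjoint_notin => x; exact: AND.
  - split; rewrite -?setI_eq0 ?set0I ?set0U //; first by move=> x y; rewrite in_set0.
      exact: hub_independent.
    by move=> x y; rewrite in_set0.
  - by rewrite set0U; apply: triangle_free_disjoint_union.
  - by split; try apply: edges_between_eq0; move=> x y; rewrite ?in_set0.
  move=> _; exists d; first exact: hub_d.
  by move=> _ y /set1P-> /NW.
have [s Ss sR] := dominating_S Rr0.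
have V1_AN x : x \in A :|: N :\: S -> x \in A :|: N.
  by rewrite !in_setU in_setD => /orP[->|/andP[_ ->]]; rewrite ?orbT.
have V1_R x y : x \in A :|: N :\: S -> y \in R -> ~~ adj x y.
  move=> V1x Ry; case/setUP: V1x => [Ax|/setDP[Nx nSx]].
    by apply: A_far Ax _; rewrite in_setU Ry orbT.
  apply: contra nSx => xy; rewrite inE Nx; apply/exists_inP.
  by exists y.
have far_N x : x \in N -> x \in N :|: R by rewrite in_setU => ->.
have far_R x : x \in R -> x \in N :|: R by rewrite in_setU orbC => ->.
have D_not x : x \in D -> [/\ x \notin A, x \notin N & x \notin R].
  move=> Dx; split; [apply/negP=> /A_notin_D | apply/negP => /far_N/far_notin_D
                    | apply/negP => /far_R/far_notin_D]; by rewrite Dx.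
have S_D x : x \in S -> x \notin D by move=> /S_sub_N/far_N/far_notin_D.
exists (A :|: N :\: S), (D :|: S), R, D, S; split; last split.
- split; last split.
  + apply/setP=> x; rewrite in_setT !in_setU in_setD; apply/esym.
    have := classes_cover x; case: (x \in S); rewrite ?orbT //=.
    by case/or4P=> ->; rewrite ?orbT.
  + apply: disjoint_notin => x /setUP[Ax|/setDP[Nx nSx]]; rewrite in_setU negb_or.
      rewrite A_notin_D //=; apply/negP => /S_sub_N/far_N/far_notin_A.
      by rewrite Ax.
    by rewrite nSx andbT; apply/far_notin_D/far_N.
  + apply: disjoint_notin => x /setUP[Ax|/setDP[Nx _]]; last exact: N_notin_R.
    by apply/negP => /far_R/far_notin_A; rewrite Ax.
  + by apply: disjoint_notin => x /setUP[/D_not[]|/S_sub_N/N_notin_R].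
- split=> //.
  + rewrite disjoint_sym; apply: disjoint_notin => x; exact: S_D.
  + exact: hub_independent.
  + by move=> x y Sx /S_sub_N; apply: S_isolated.
  + by move=> x y Dx /S_sub_N Ny; rewrite adj_sym N_hub.
(* [V1] lies in the neighbourhood of [d], and [R] in that of the dominating vertex [s]. *)
- apply: triangle_free_disjoint_union; apply: triangle_free_onU V1_R.
    by apply: (neighbourhood_triangle_free (d := d)) => x /V1_AN/NW.
  exact: neighbourhood_triangle_free sR.
- split; try apply: edges_between_eq0.
  + move=> x y /V1_AN/setUP[Ax|Nx] Dy; [exact: A_hub | exact: N_hub].
  + move=> x y /setUP[Ax|/setDP[Nx _]] Sy; apply/negP.
      exact: A_far Ax (far_N _ (S_sub_N Sy)).
    by rewrite adj_sym; apply: S_isolated.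
  + by move=> x y V1x Ry; apply/negP/V1_R.
  by move=> x y Rx Dy; apply/negP/R_hub.
by move=> _; exists s => // _ y /set1P->; apply: sR.
Qed.

End Hub.

(** * The case without hubs *)

(** All of [G] is one expansion of C5, so [V1] is the whole vertex set, as a single part, and the
    guarded clause holds vacuously. *)
Lemma no_hub_decomposition (v0 v1 v2 v3 v4 : G) : connected G ->
    C5_on v0 v1 v2 v3 v4 ->
    (forall d, ~~ all (adj d) [:: v0; v1; v2; v3; v4]) ->
  decomposition G.
Proof.
move=> G_connected C5 no_hub.
have expG : is_C5_expansion (induced [set: G]).
  apply: connected_C5_expansion (connected_setT G_connected) C5 _ _ => //.
  by rewrite /= !inE.
exists [set: G], set0, set0, set0, set0; split; last split.
- by rewrite !setU0 -!setI_eq0 !setI0 eqxx.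
- by rewrite /complete_bipartite_on setU0 -setI_eq0 setI0 eqxx; split=> // x; rewrite inE.
- rewrite setU0; exists [set [set: G]]; first split.
  + apply/and3P; split.
    * by rewrite /cover big_set1.
    * by apply/trivIsetP=> X Y /set1P-> /set1P->; rewrite eqxx.
    by apply/set1P => /setP/(_ v0); rewrite !inE.
  + by move=> _ /set1P->; left.
  by move=> X Y /set1P-> /set1P->; rewrite eqxx.
- by split; try apply: edges_between_eq0; move=> x y; rewrite ?inE.
by rewrite eqxx.
Qed.

End Free.

Theorem theorem2p3 (G : sgraph)
  (G_connected : connected G)
  (G_free : family_free P5_K4_kite_bull G)
  (G_C5 : contains_induced G (cycle_graph 5)) :
  exists V1 V2 V3 B S : {set G},
    ([set: G] = V1 :|: V2 :|: V3 /\
     [/\ [disjoint V1 & V2], [disjoint V1 & V3] & [disjoint V2 & V3]]) /\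
    [/\ complete_bipartite_on V2 B S,
        disjoint_union_of (fun H => is_C5_expansion H \/ bipartite H)
          (V1 :|: V3),
        [/\ complete_between V1 B, edges_between V1 S = set0,
            edges_between V1 V3 = set0 & edges_between V3 B = set0]
      & V1 != [set: G] ->
        exists2 x : G, x \in S & complete_between [set x] V3].
Proof.
have [v0 [v1 [v2 [v3 [v4 C5]]]]] := C5_on_contains G_C5.
have [d d_hub | no_hub] := pickP (fun d => all (@adj G d) [:: v0; v1; v2; v3; v4]).
  exact: hub_decomposition C5 d_hub G_connected.
by apply: (no_hub_decomposition G_free G_connected C5) => d; rewrite no_hub.
Qed.
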